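(* If $D$ is a tournament on $n$ vertices, then the multiplicity of $-1$ as a root of $A_D(t)$ equals $\lfloor n/2\rfloor$.
   Context: A tournament is an orientation of a complete graph. For an $n$-vertex digraph $D$, a descent of a bijection $\sigma:V(D)\to[n]$ is an arc $u\to v$ with $\sigma(u)>\sigma(v)$, $\mathrm{des}_D(\sigma)$ is the number of descents, and $A_D(t)=\sum_\sigma t^{\mathrm{des}_D(\sigma)}$ over all such bijections. *)

(* Defs.v *)
From mathcomp Require Import all_boot all_order all_algebra.
Set Implicit Arguments.
Unset Strict Implicit.
Unset Printing Implicit Defensive.
Import GRing.Theory.
Local Open Scope ring_scope.

(* A digraph on the vertex set V is given by its arc relation: D u v means
   u -> v. *)

Definition tournament (V : finType) (D : rel V) : Prop :=
  irreflexive D /\ (forall u v : V, u != v -> D u v (+) D v u).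

Definition bijectiveb (S T : finType) (f : {ffun S -> T}) : bool :=
  injectiveb f && [forall y : T, y \in codom f].

Lemma bijectivebP (S T : finType) (f : {ffun S -> T}) :
  reflect (bijective f) (bijectiveb f).
Proof.
apply: (iffP andP) => [[/injectiveP injf /forallP surjf]|bijf].
  exists (fun y => iinv (surjf y)) => [x|y]; last exact: f_iinv.
  by apply: injf; rewrite f_iinv.
split; first by apply/injectiveP; apply: bij_inj.
by case: bijf => g _ gK; apply/forallP => y; rewrite -(gK y) codom_f.
Qed.

(* The labels 1, ..., n are shifted to 0, ..., n - 1; this does not affect
   descents. *)
Definition des (V : finType) (D : rel V) (sigma : {ffun V -> 'I_#|V|}) : nat :=
  #|[set a : V * V | D a.1 a.2 & (sigma a.2 < sigma a.1)%N]|.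

Definition descent_poly (V : finType) (D : rel V) : {poly rat} :=
  \sum_(sigma : {ffun V -> 'I_#|V|} | bijectiveb sigma) 'X^(des D sigma).

(* Main.v *)
Require Import Defs.
From mathcomp Require Import all_boot all_order all_algebra.
From mathcomp Require Import all_fingroup all_solvable zify.
Set Implicit Arguments.
Unset Strict Implicit.
Unset Printing Implicit Defensive.
Import GRing.Theory Num.Theory.
Local Open Scope ring_scope.

(** Label the vertices 0, ..., n - 1 and put m = n / 2.  Exchanging the labels
    2j and 2j + 1 toggles only the descent on the arc between their two
    vertices, so collapsing these two labels into one takes a factor
    [(1 + t) / 2] out of the descent polynomial.  Doing this for every j < m
    gives [2 ^ m * A(t) = (1 + t) ^ m * Q(t)], where Q sums [t ^ (weak_des p)]
    over all permutations p and [weak_des p] only counts the descents between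
    vertices whose labels have distinct halves.

    It remains to see that [Q(-1)], a sum of signs over the symmetric group S,
    is nonzero.  The sign of p does not change when p is followed by a
    permutation commuting with the involution c that exchanges all 2j and
    2j + 1: two blocks of labels are joined by four arcs, or by two if one of
    them is the unpaired last label, so reversing the order of two blocks
    preserves parity.  Hence [Q(-1)] is the order of the centraliser of c times
    a sum of [#|c ^: S|] signs, and it suffices that this class is odd: the
    2-group of all h with h x = x or h x = c x for every x acts on it by
    conjugation, with c as its only fixed point. *)

Lemma mup_mulrn (F : numFieldType) (x : F) (p : {poly F}) k :
  (0 < k)%N -> mup x (p *+ k) = mup x p.
Proof.
by move=> k_gt0; rewrite -mulr_natl mupMr // -polyC_natr rootC pnatr_eq0 -lt0n.
Qed.

Lemma sum_signs_neq0 (R : numDomainType) (I : finType) (A : {set I})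
    (e : I -> nat) :
  odd #|A| -> \sum_(i in A) (-1) ^+ e i != 0 :> R.
Proof.
move=> oddA; have signE k : (-1) ^+ k = 1 - (odd k).*2%:R :> R.
  rewrite -signr_odd; case: (odd k); rewrite ?subr0 //.
  by rewrite -[2%:R]/(1 + 1) opprD addrA subrr add0r.
under eq_bigr do rewrite signE.
rewrite sumrB sumr_const -natr_sum subr_eq0 eqr_nat.
apply: contraTneq oddA => ->; rewrite (big_morph odd oddD (erefl _)).
by rewrite big1 // => i _; rewrite odd_double.
Qed.

Lemma sum_lcoset_signs_neq0 (R : numDomainType) (gT : finGroupType)
    (G H : {group gT}) (e : gT -> nat) :
  H \subset G -> odd #|G : H|%g ->
  {in G & H, forall x h, odd (e (x * h)%g) = odd (e x)} ->
  \sum_(x in G) (-1) ^+ e x != 0 :> R.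
Proof.
move=> sHG oddGH eH; have imG x : x \in G -> lcoset H x \in lcosets H G.
  by move=> Gx; apply: imset_f.
rewrite (partition_big (lcoset H) _ imG) /=.
rewrite (eq_bigr (fun C => (-1) ^+ e (repr C) *+ #|H|)).
  rewrite sumrMnl mulrn_eq0 negb_or -lt0n cardG_gt0.
  by rewrite sum_signs_neq0 ?card_lcosets.
move=> _ /imsetP[y Gy ->].
rewrite lcosetE -(card_lcoset H y) -sumr_const.
have coset_sign x : x \in (y *: H)%g -> (-1) ^+ e x = (-1) ^+ e y :> R.
  by case/lcosetP=> h Hh ->; rewrite -signr_odd eH // signr_odd.
apply: eq_big => [x|x /andP[_ /eqP xH]].
  rewrite lcosetE (sameP eqP lcoset_eqP) andb_idl // => /lcosetP[h Hh ->].
  by rewrite groupM // (subsetP sHG).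
rewrite (coset_sign _ (mem_repr y (lcoset_refl H y))) coset_sign //.
by apply/lcoset_eqP; rewrite -lcosetE.
Qed.

Lemma even_sum_involution (T : finType) (phi : T -> T) (F : T -> nat) :
  involutive phi -> (forall x, F (phi x) = F x) ->
  (forall x, phi x = x -> F x = 0%N) -> ~~ odd (\sum_x F x).
Proof.
move=> phiK Fphi Ffix.
rewrite (bigID (fun x => phi x == x)) /= big1 ?add0n => [|x /eqP/Ffix//].
rewrite (bigID (fun x => enum_rank x < enum_rank (phi x))%N) /=.
rewrite [X in (_ + X)%N](reindex_inj (inv_inj phiK)) /=.
under [X in (_ + X)%N]eq_bigr do rewrite Fphi.
rewrite [X in (_ + X)%N](eq_bigl (fun x =>
  (phi x != x) && (enum_rank x < enum_rank (phi x))%N)) ?addnn ?odd_double //.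
move=> x; rewrite phiK -leqNgt leq_eqVlt val_eqE (inj_eq enum_rank_inj).
by rewrite eq_sym; case: (phi x == x).
Qed.

Lemma eq_sum_symmetrised (T : finType) (F G : T -> T -> nat) :
  (forall u v, F u v + F v u = G u v + G v u)%N ->
  (\sum_u \sum_v F u v = \sum_u \sum_v G u v)%N.
Proof.
move=> FG; apply: double_inj; rewrite -!addnn.
rewrite {1}exchange_big [X in _ = (X + _)%N]exchange_big -!big_split.
apply: eq_bigr => u _; rewrite -!big_split.
by apply: eq_bigr => v _; exact: FG.
Qed.

Section InvolutionClass.

Variables (T : finType) (c : {perm T}).
Hypothesis cK : involutive c.
Hypothesis fixed_unique : forall x y, c x = x -> c y = y -> x = y.

Definition orbitwise_perm : {set {perm T}} :=
  [set h : {perm T} | [forall x, h x \in [:: x; c x]]].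

Lemma orbitwise_permP (h : {perm T}) :
  reflect (forall x, h x = x \/ h x = c x) (h \in orbitwise_perm).
Proof.
rewrite inE; apply: (iffP forallP) => hc x.
  by move: (hc x); rewrite !inE => /orP[] /eqP; [left|right].
by rewrite !inE; case: (hc x) => ->; rewrite eqxx ?orbT.
Qed.

Lemma orbitwise_perm_group_set : group_set orbitwise_perm.
Proof.
apply/group_setP; split.
  by apply/orbitwise_permP => x; left; rewrite perm1.
move=> g h /orbitwise_permP gc /orbitwise_permP hc.
apply/orbitwise_permP => x; rewrite permM.
by case: (hc (g x)) => ->; case: (gc x) => ->; rewrite ?cK; auto.
Qed.

Canonical orbitwise_perm_group := Group orbitwise_perm_group_set.

Lemma tperm_orbitwise (x : T) : tperm x (c x) \in orbitwise_perm.
Proof.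
by apply/orbitwise_permP => y; case: tpermP => [->|->|]; rewrite ?cK; auto.
Qed.

Lemma orbitwise_permC (h : {perm T}) (x : T) :
  h \in orbitwise_perm -> h (c x) = c (h x).
Proof.
move/orbitwise_permP => hc.
have [hx|hx] := hc x; have [hcx|hcx] := hc (c x); rewrite hx hcx //.
  by have /perm_inj cx : h (c x) = h x; [rewrite hcx cK hx | rewrite !cx].
by have /perm_inj cx := etrans hcx (esym hx); rewrite !cx.
Qed.

Lemma orbitwise_perm_pgroup : (2.-group orbitwise_perm)%g.
Proof.
apply: abelem_pgroup; apply: exponent2_abelem; apply/exponentP => h Eh.
apply/permP => x; rewrite expgS expg1 permM perm1.
case/orbitwise_permP/(_ x): (Eh) => hx; rewrite hx //.
by rewrite orbitwise_permC // hx cK.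
Qed.

Lemma involutiveJ (g : {perm T}) : involutive (c ^ g)%g.
Proof. by move=> x; rewrite -(permKV g x) !permJ cK. Qed.

Lemma fixed_uniqueJ (g : {perm T}) (x y : T) :
  (c ^ g)%g x = x -> (c ^ g)%g y = y -> x = y.
Proof.
rewrite -(permKV g x) -(permKV g y) !permJ => /perm_inj cx /perm_inj cy.
by congr (g _); exact: fixed_unique.
Qed.

Lemma class_cent_orbitwise :
  (c ^: [set: {perm T}] :&: 'C(orbitwise_perm) = [set c])%g.
Proof.
apply/setP => p; rewrite in_setI inE; apply/andP/eqP => [[]|->]; last first.
  split; first exact: class_refl.
  by apply/centP => h Eh; apply/permP => x; rewrite !permM orbitwise_permC.
case/imsetP=> g _ ->; move: (c ^ g)%g (involutiveJ g) (@fixed_uniqueJ g).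
move=> {}p pK fixed_p /centP cEp.
have p_nonfixed x : c x != x -> p x = c x.
  move=> cx; have /permP/(_ x) := cEp _ (tperm_orbitwise x).
  rewrite !permM tpermL; case: tpermP => // [px pcx|_ _ /perm_inj xE].
    by rewrite [c x](fixed_p _ x) ?eqxx in cx.
  by rewrite -xE eqxx in cx.
apply/permP => x; have [cx|] := eqVneq (c x) x; last exact: p_nonfixed.
have [cpx|/p_nonfixed] := eqVneq (c (p x)) (p x).
  by rewrite cx; apply: fixed_unique.
by rewrite pK => xE; rewrite [in RHS]xE cK.
Qed.

Lemma odd_card_involution_class : odd #|c ^: [set: {perm T}]|%g.
Proof.
have /(pgroup_fix_mod orbitwise_perm_pgroup) :
    [acts orbitwise_perm, on c ^: [set: {perm T}] | 'J]%g.
  by rewrite astabsJ (subset_trans (subsetT _)) ?class_norm.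
by rewrite afixJ class_cent_orbitwise cards1 !modn2; case: (odd _).
Qed.

End InvolutionClass.

Definition weak_des (V : finType) (D : rel V) (f : V -> nat) : nat :=
  #|[set a : V * V | D a.1 a.2 & (f a.2 < f a.1)%N]|.

Definition inversions (V : finType) (f g : V -> nat) : nat :=
  \sum_u \sum_v ((f v < f u) && (g u < g v))%N.

Lemma even_inversions (V : finType) (phi : V -> V) (f g : V -> nat) :
  involutive phi -> (forall v, f (phi v) = f v) ->
  (forall v, g (phi v) = g v) ->
  (forall u v, phi v = v -> (f u <= f v)%N) -> ~~ odd (inversions f g).
Proof.
move=> phiK fphi gphi f_max; rewrite /inversions exchange_big.
apply: (even_sum_involution phiK) => v => [|v_fix]; last first.
  by rewrite big1 // => u _; rewrite ltnNge f_max.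
by apply: eq_bigr => u _; rewrite fphi gphi.
Qed.

Section WeakDescents.

Variables (V : finType) (D : rel V).
Implicit Types f g : V -> nat.

Lemma eq_weak_des f g : f =1 g -> weak_des D f = weak_des D g.
Proof. by move=> fg; apply: eq_card => a; rewrite !inE !fg. Qed.

Lemma weak_desE f :
  weak_des D f = (\sum_u \sum_v (D u v && (f v < f u)))%N.
Proof.
rewrite pair_big /weak_des -sum1_card big_mkcond.
by apply: eq_bigr => a _; rewrite inE.
Qed.

Lemma weak_des_refine f g x y :
  (forall u v, (f v < f u) = (g v < g u) || (u == y) && (v == x))%N ->
  (g y <= g x)%N -> weak_des D f = (D y x + weak_des D g)%N.
Proof.
move=> fg gyx; rewrite !weak_desE !pair_big (bigD1 (y, x)) //.
rewrite [in RHS](bigD1 (y, x)) //= fg !eqxx orbT andbT ltnNge gyx andbF.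
congr (_ + _)%N; apply: eq_bigr => -[u v]; rewrite fg xpair_eqE => /negPf->.
by rewrite orbF.
Qed.

Hypothesis tD : tournament D.

Lemma tournament_arcN u v : u != v -> D u v = ~~ D v u.
Proof. by case: tD => _ /[apply]; case: (D u v) (D v u) => [] []. Qed.

Lemma odd_weak_des_inversions f g :
  (forall u v, (f u == f v) = (g u == g v)) ->
  odd (weak_des D g) = odd (weak_des D f) (+) odd (inversions f g).
Proof.
move=> fg; rewrite -oddD.
pose reversed := (\sum_u \sum_v [&& D u v, f v < f u & g u < g v])%N.
suff -> : (weak_des D f + inversions f g = weak_des D g + reversed.*2)%N.
  by rewrite oddD odd_double addbF.
rewrite -mul2n !weak_desE /reversed big_distrr -!big_split /=.
under eq_bigr do rewrite -big_split.
under [RHS]eq_bigr do rewrite big_distrr -big_split.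
(* Both sides agree on {u, v} since exactly one of D u v and D v u holds. *)
apply: eq_sum_symmetrised => u v /=; have [->|/tournament_arcN->] := eqVneq u v.
  by rewrite !ltnn !andbF.
by have := fg u v; case: (D v u) => /=; lia.
Qed.

End WeakDescents.

Lemma weak_des_relpre (V W : finType) (D : rel V) (r : W -> V) (f : V -> nat) :
  bijective r -> weak_des (relpre r D) (f \o r) = weak_des D f.
Proof.
move=> r_bij; rewrite !weak_desE [RHS](reindex r) /=; last exact: onW_bij.
by apply: eq_bigr => u _; rewrite [RHS](reindex r) //; exact: onW_bij.
Qed.

Lemma tournament_relpre (V W : finType) (D : rel V) (r : W -> V) :
  injective r -> tournament D -> tournament (relpre r D).
Proof.
move=> r_inj [irrD arcD]; split=> [w|u v]; first exact: irrD.
by rewrite -(inj_eq r_inj); exact: arcD.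
Qed.

Section Labels.

Variable n : nat.
Implicit Types (i j : 'I_n) (p h : 'S_n).

(** For odd [n], [insubd] makes the unpaired last label its own mate. *)
Definition mate i : 'I_n := insubd i (if odd i then i.-1 else i.+1).

Lemma val_mate i :
  mate i = (if odd i then i.-1 else if i.+1 < n then i.+1 else i)%N :> nat.
Proof.
rewrite val_insubd; case: (odd i) => //.
by rewrite (leq_ltn_trans (leq_pred i)).
Qed.

Lemma mateK : involutive mate.
Proof.
move=> i; apply: val_inj; rewrite /= !val_mate.
by have := ltn_ord i; do !case: ifP; lia.
Qed.

Lemma eq_half_mate i j : (i./2 == j./2) = (j == i) || (j == mate i).
Proof.
rewrite -!val_eqE /= val_mate; have := ltn_ord i; have := ltn_ord j.
by do !case: ifP; lia.
Qed.

Lemma half_mate i : (mate i)./2 = i./2.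
Proof. by apply/esym/eqP; rewrite eq_half_mate eqxx orbT. Qed.

Lemma mate_fixed_max i j : mate i = i -> (j./2 <= i./2)%N.
Proof.
move=> /(congr1 val); rewrite /= val_mate.
by have := ltn_ord i; have := ltn_ord j; do !case: ifP; lia.
Qed.

Definition mate_perm : 'S_n := perm (inv_inj mateK).

Lemma odd_index_cent_mate :
  odd #|[set: 'S_n] : 'C_([set: 'S_n])[mate_perm]|%g.
Proof.
rewrite index_cent1; apply: odd_card_involution_class => [i|i j].
  by rewrite !permE mateK.
rewrite !permE => fix_i fix_j; have := eq_half_mate i j.
rewrite fix_i orbb => ji.
by apply/esym/eqP; rewrite -ji eqn_leq !mate_fixed_max.
Qed.

Lemma cent_mate_eq_half h i j :
  h \in 'C[mate_perm]%g -> ((h i)./2 == (h j)./2) = (i./2 == j./2).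
Proof.
move/cent1P=> /permP/(_ i); rewrite !permM !permE => h_mate.
by rewrite !eq_half_mate h_mate !(inj_eq perm_inj).
Qed.

Lemma odd_weak_des_half_cent (D : rel 'I_n) p h :
  tournament D -> h \in 'C[mate_perm]%g ->
  odd (weak_des D (fun u => ((p * h)%g u)./2)) =
  odd (weak_des D (fun u => (p u)./2)).
Proof.
move=> tD h_cent; have p_half u v := cent_mate_eq_half (p u) (p v) h_cent.
under eq_weak_des do rewrite permM.
rewrite (odd_weak_des_inversions tD (fun u v => esym (p_half u v))).
rewrite [odd (inversions _ _)]negbTE ?addbF //.
apply: (even_inversions (phi := fun u => p^-1%g (mate (p u)))) => [u|u|u|u v].
- by rewrite permKV mateK permK.
- by rewrite permKV half_mate.
- by apply/eqP; rewrite p_half permKV half_mate.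
- by move/(canRL (permKV p)); exact: mate_fixed_max.
Qed.

End Labels.

(** The monotone map identifying the labels [2j] and [2j + 1] for [j < k]. *)
Definition collapse k i := maxn i./2 (i - k).

Lemma collapse0 i : collapse 0 i = i.
Proof. by rewrite /collapse; lia. Qed.

Lemma collapse_half n i : (i < n)%N -> collapse n./2 i = i./2.
Proof. by rewrite /collapse; lia. Qed.

Lemma ltn_collapse k i j :
  (collapse k j < collapse k i)%N =
  (collapse k.+1 j < collapse k.+1 i)%N || (i == k.*2.+1) && (j == k.*2).
Proof. by rewrite /collapse; lia. Qed.

Section CollapsedDescentPolynomial.

Variables (R : nzRingType) (n : nat) (D : rel 'I_n).

Definition collapsed_descent_poly k : {poly R} :=
  \sum_(p : 'S_n) 'X^(weak_des D (fun u => collapse k (p u))).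

Hypothesis tD : tournament D.

Lemma collapsed_descent_polyS k :
  (k < n./2)%N ->
  collapsed_descent_poly k *+ 2 = ('X + 1) * collapsed_descent_poly k.+1.
Proof.
move=> lt_k; have [lt_low lt_high] : (k.*2 < n /\ k.*2.+1 < n)%N by lia.
pose low := Ordinal lt_low; pose high := Ordinal lt_high.
pose collapsed_des k' (p : 'S_n) := weak_des D (fun u => collapse k' (p u)).
have refine p : collapsed_des k p =
    (D (p^-1%g high) (p^-1%g low) + collapsed_des k.+1 p)%N.
  apply: weak_des_refine => [u v|]; last by rewrite !permKV /collapse /=; lia.
  by rewrite ltn_collapse -!(can2_eq (permK p) (permKV p)).
pose swap p : 'S_n := (p * tperm low high)%g.
have swap_low p : (swap p)^-1%g low = p^-1%g high.
  by rewrite /swap invMg permM tpermV tpermL.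
have swap_high p : (swap p)^-1%g high = p^-1%g low.
  by rewrite /swap invMg permM tpermV tpermR.
have collapse_swap p : collapsed_des k.+1 (swap p) = collapsed_des k.+1 p.
  apply: eq_weak_des => u; rewrite permM.
  by case: tpermP => [->|->|//]; rewrite /collapse /=; lia.
rewrite mulr2n {2}/collapsed_descent_poly.
rewrite (reindex_inj (mulIg (tperm low high))) -big_split mulr_sumr.
apply: eq_bigr => p _ /=; rewrite -/(swap p) -!/(collapsed_des _ _).
rewrite !refine swap_low swap_high collapse_swap !exprD -mulrDl.
congr (_ * _); rewrite (tournament_arcN tD); last first.
  by rewrite (inj_eq perm_inj) -val_eqE /=; lia.
by case: (D _ _); rewrite ?expr0 ?expr1 // addrC.
Qed.

Lemma collapsed_descent_poly0 k :
  (k <= n./2)%N ->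
  collapsed_descent_poly 0 *+ 2 ^ k = ('X + 1) ^+ k * collapsed_descent_poly k.
Proof.
elim: k => [|k IH] lt_k; first by rewrite mul1r.
rewrite expnSr mulrnA IH 1?ltnW // -mulrnAr collapsed_descent_polyS //.
by rewrite mulrA exprSr.
Qed.

End CollapsedDescentPolynomial.

Lemma horner_collapsed_descent_poly_neq0 (R : numDomainType) n (D : rel 'I_n) :
  tournament D -> (collapsed_descent_poly R D n./2).[-1] != 0.
Proof.
move=> tD; rewrite horner_sum.
under eq_bigr do rewrite hornerXn.
under eq_bigl => p do rewrite -(in_setT p).
apply: (sum_lcoset_signs_neq0 _ _ (odd_index_cent_mate n)) => [|p h _].
  exact: subsetIl.
rewrite inE => /andP[_ h_cent].
have half_collapse (q : 'S_n) : weak_des D (fun u => collapse n./2 (q u)) =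
    weak_des D (fun u => (q u)./2).
  by apply: eq_weak_des => u; rewrite collapse_half.
by rewrite !half_collapse odd_weak_des_half_cent.
Qed.

Section PermutationLabellings.

Variable V : finType.

Definition perm_labelling (p : 'S_#|V|) : {ffun V -> 'I_#|V|} :=
  [ffun v => p (enum_rank v)].

Lemma perm_labellingE (p : 'S_#|V|) (i : 'I_#|V|) :
  perm_labelling p (enum_val i) = p i.
Proof. by rewrite ffunE enum_valK. Qed.

Lemma perm_labelling_inj : injective perm_labelling.
Proof.
by move=> p q pq; apply/permP => i; rewrite -!perm_labellingE pq.
Qed.

Lemma perm_labellingP (sigma : {ffun V -> 'I_#|V|}) :
  reflect (exists p, sigma = perm_labelling p) (bijectiveb sigma).
Proof.
apply: (iffP (bijectivebP _)) => [sigma_bij|[p ->]].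
  have p_inj : injective (fun i : 'I_#|V| => sigma (enum_val i)).
    by move=> i j /(bij_inj sigma_bij)/enum_val_inj.
  by exists (perm p_inj); apply/ffunP => v; rewrite ffunE permE /= enum_rankK.
exists (fun i => enum_val (p^-1%g i)) => [v|i].
  by rewrite ffunE permK enum_rankK.
by rewrite perm_labellingE permKV.
Qed.

Lemma descent_polyE (D : rel V) :
  descent_poly D = collapsed_descent_poly rat (relpre (@enum_val V V) D) 0.
Proof.
rewrite /descent_poly (eq_bigl [in perm_labelling @: setT]) => [|sigma].
  rewrite big_imset /=; last by move=> p q _ _; exact: perm_labelling_inj.
  apply: eq_big => [p|p _]; first exact: in_setT.
  congr 'X^_; rewrite -[LHS]/(weak_des D (fun v => perm_labelling p v)).
  rewrite -(weak_des_relpre _ _ (enum_val_bij V)).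
  by apply: eq_weak_des => i /=; rewrite perm_labellingE collapse0.
apply/perm_labellingP/imsetP => [[p ->]|[p _ ->]]; last by exists p.
by exists p; rewrite ?inE.
Qed.

End PermutationLabellings.

Theorem theorem1p9 (n : nat) (V : finType) (D : rel V) :
  #|V| = n -> tournament D -> mup (-1) (descent_poly D) = (n %/ 2)%N.
Proof.
move=> <- /(tournament_relpre (@enum_val_inj V V)) tD.
rewrite descent_polyE divn2; set m := #|V|./2.
rewrite -(mup_mulrn _ _ (expn_gt0 2 m)) (collapsed_descent_poly0 _ tD) //.
rewrite mupMl; last exact: horner_collapsed_descent_poly_neq0.
have -> : 'X + 1 = 'X - (-1)%:P :> {poly rat} by rewrite polyCN opprK.
by rewrite mup_XsubCX eqxx.
Qed.
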